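(* Let $(X,\|\cdot\|,\preceq)$ be a Banach space endowed with a partial order $\preceq$ for which all order intervals $[a,\rightarrow)$ and $(\leftarrow,b]$ ($a,b\in X$) are convex and closed. Assume that $(X,\|\cdot\|)$ is uniformly convex. Let $C$ be a nonempty convex closed bounded subset of $X$ not reduced to one point. Assume that $X$ satisfies the monotone weak-Opial condition. Let $T: C\rightarrow C$ be a monotone asymptotic nonexpansive mapping. Then $T$ has a fixed point if and only if there exists $x_0\in C$ such that $x_0$ and $T(x_0)$ are comparable.
   Context: The partial order $\preceq$ on $X$ is not assumed to have any compatibility with the linear structure or the norm beyond what is stated. Two elements $x,y$ are comparable if $x\preceq y$ or $y\preceq x$. Order intervals are the sets $[a,\rightarrow)=\{x\in X:\ a\preceq x\}$ and $(\leftarrow,b]=\{x\in X:\ x\preceq b\}$ for $a,b\in X$. The Banach space $X$ is uniformly convex if for every $\varepsilon>0$, $\delta(\varepsilon)=\inf\{1-\|\frac{x+y}{2}\|:\ \|x\|\le 1,\ \|y\|\le 1,\ \|x-y\|\ge\varepsilon\}>0$ (with $\inf\emptyset=+\infty$). A sequence $\{x_n\}$ is monotone increasing if $x_n\preceq x_{n+1}$ for all $n$, and monotone decreasing if $x_{n+1}\preceq x_n$ for all $n$. $X$ satisfies the monotone weak-Opial condition if, whenever a monotone increasing (resp. decreasing) sequence $\{x_n\}$ in $X$ converges weakly to $x$, one has $\limsup_{n\to+\infty}\|x_n-x\|\le\limsup_{n\to+\infty}\|x_n-y\|$ for every $y\in X$ such that $x\preceq y$ (resp. $y\preceq x$). A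 map $T:C\to C$ is monotone if $x\preceq y$ implies $T(x)\preceq T(y)$ for all $x,y\in C$. $T$ is a monotone asymptotic nonexpansive mapping if $T$ is monotone and there exists a sequence $\{k_n\}$ of positive numbers with $\lim_{n\to+\infty}k_n=1$ such that $\|T^n(x)-T^n(y)\|\le k_n\|x-y\|$ for every $n$ and all comparable $x,y\in C$ (continuity of $T$ is not assumed). A fixed point of $T$ is a point $x\in C$ with $T(x)=x$. *)

(* Defs.v *)
From HB Require Import structures.
From mathcomp Require Import all_boot all_order all_algebra.
From mathcomp Require Import all_classical all_reals all_analysis.

Set Implicit Arguments.
Unset Strict Implicit.
Unset Printing Implicit Defensive.

Import Order.TTheory GRing.Theory Num.Theory.
Import numFieldNormedType.Exports.

Local Open Scope classical_set_scope.
Local Open Scope ring_scope.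

Definition comparable_for (X : Type) (le : rel X) (x y : X) : Prop :=
  le x y \/ le y x.

(* [a, ->) and (<-, b] *)
Definition upper_interval (X : Type) (le : rel X) (a : X) : set X :=
  [set x | le a x].

Definition lower_interval (X : Type) (le : rel X) (b : X) : set X :=
  [set x | le x b].

Definition convex_closed_intervals (R : realType) (X : normedModType R)
    (le : rel X) : Prop :=
  (forall a : X, convex_set (upper_interval le a) /\
                 closed (upper_interval le a)) /\
  (forall b : X, convex_set (lower_interval le b) /\
                 closed (lower_interval le b)).

(* Extended-real valued, so that the infimum of the empty set is +oo. *)
Definition convexity_modulus (R : realType) (X : normedModType R) (eps : R) :
    \bar R :=
  ereal_inf [set d : \bar R | exists x y : X,
    [/\ `|x| <= 1, `|y| <= 1, eps <= `|x - y| &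
        d = (1 - `|2^-1 *: (x + y)|)%:E]].

Definition uniformly_convex (R : realType) (X : normedModType R) : Prop :=
  forall eps : R, 0 < eps -> (0 < convexity_modulus X eps)%E.

Definition monotone_increasing (X : Type) (le : rel X) (u : nat -> X) : Prop :=
  forall n, le (u n) (u n.+1).

Definition monotone_decreasing (X : Type) (le : rel X) (u : nat -> X) : Prop :=
  forall n, le (u n.+1) (u n).

Definition weakly_converges (R : realType) (X : normedModType R)
    (u : nat -> X) (x : X) : Prop :=
  forall f : {linear X -> R^o}, continuous f -> f (u n) @[n --> \oo] --> f x.

Definition limsup_dist (R : realType) (X : normedModType R)
    (u : nat -> X) (y : X) : \bar R :=
  limn_esup (fun n => `|u n - y|%:E).

Definition monotone_weak_Opial (R : realType) (X : normedModType R)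
    (le : rel X) : Prop :=
  (forall (u : nat -> X) (x : X),
     monotone_increasing le u -> weakly_converges u x ->
     forall y, le x y -> (limsup_dist u x <= limsup_dist u y)%E) /\
  (forall (u : nat -> X) (x : X),
     monotone_decreasing le u -> weakly_converges u x ->
     forall y, le y x -> (limsup_dist u x <= limsup_dist u y)%E).

(* Values of T outside C are never constrained. *)
Definition monotone_on (X : Type) (le : rel X) (C : set X) (T : X -> X) : Prop :=
  forall x y, C x -> C y -> le x y -> le (T x) (T y).

Definition monotone_asymptotic_nonexpansive (R : realType)
    (X : normedModType R) (le : rel X) (C : set X) (T : X -> X) : Prop :=
  monotone_on le C T /\
  exists k : nat -> R,
    [/\ forall n, 0 < k n,
        k n @[n --> \oo] --> (1 : R) &
        forall n x y, C x -> C y -> comparable_for le x y ->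
          `|iter n T x - iter n T y| <= k n * `|x - y|].

(* Main.v *)
Require Import Defs.
From HB Require Import structures.
From mathcomp Require Import all_boot all_order all_algebra.
From mathcomp Require Import all_classical all_reals all_analysis.
From mathcomp Require wochoice.
From mathcomp Require Import lra.

Set Implicit Arguments.
Unset Strict Implicit.
Unset Printing Implicit Defensive.

Import Order.TTheory GRing.Theory Num.Theory.
Import numFieldNormedType.Exports.

Local Open Scope classical_set_scope.
Local Open Scope ring_scope.

(* Let u_n = T^n x0 with x0 <= T x0.  Nested bounded closed convex sets meet in
   a uniformly convex Banach space, so the increasing sequence u has a least
   upper bound x in C, and x lies in every closed half-space that contains u_n
   for infinitely many n; hence u converges weakly to x, without any appeal to
   reflexivity.  By the Opial condition x minimises y |-> limsup |u_n - y| over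
   the y >= x.  The points T^m x are upper bounds of u, hence above x, and
   since limsup |u_n - T^m x| <= k_m limsup |u_n - x| they form a minimising
   sequence, so uniform convexity gives T^m x --> x.  As T^m x increases,
   T x <= x, whereas x <= T x because T x is an upper bound of u. *)

(** * Uniform convexity and nested convex sets *)

Definition midpoint_convex (R : realType) (X : normedModType R) (A : set X) :=
  forall x y, A x -> A y -> A (2^-1 *: (x + y)).

Lemma convex_set_midpoint (R : realType) (X : normedModType R) (A : set X) :
  convex_set A -> midpoint_convex A.
Proof.
move=> cA x y Ax Ay.
have h0 : 0 <= (2^-1 : R) by lra.
have h1 : (2^-1 : R) <= 1 by lra.
have : A (2^-1 *: x + (1 - 2^-1) *: y).
  exact: set_mem (cA x y (Itv01 h0 h1) (mem_set Ax) (mem_set Ay)).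
rewrite scalerDr.
by have -> : 1 - 2^-1 = 2^-1 :> R by lra.
Qed.

(** Scaling by [r + h] brings [a] and [b] into the unit ball. The modulus [d] then bounds the
    midpoint by [(r + h) * (1 - d)], which is at most [r - h] once [2 * h <= r * d]. Taking [h <= 1]
    keeps the scaled points at distance at least [e / (r + 1)]. *)
Lemma uniformly_convex_midpoint (R : realType) (X : normedModType R)
    (r e : R) :
  uniformly_convex X -> 0 <= r -> 0 < e ->
  exists2 h : R, 0 < h & forall a b : X, `|a| <= r + h -> `|b| <= r + h ->
    e <= `|a - b| -> `|2^-1 *: (a + b)| <= r - h.
Proof.
move=> uc; rewrite le_eqVlt => /predU1P[<- e0|r0 e0].
  (* For radius 0 the premises are contradictory: they force [e <= e / 2]. *)
  exists (e / 4) => [|a b]; first lra.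
  rewrite add0r => a4 b4 eab; have := ler_normB a b; lra.
have es0 : 0 < e / (r + 1) by rewrite divr_gt0//; lra.
have [d d0 dP] : exists2 d : R, 0 < d & (d%:E <= convexity_modulus X (e / (r + 1)))%E.
  move: (uc _ es0); case: convexity_modulus => [d|_|//]; first by exists d.
  (* An infinite modulus leaves [d] free. *)
  by exists 1; rewrite ?leey.
exists (Num.min 1 (r * d / 2)) => [|a b].
  by rewrite lt_min ltr01 divr_gt0// mulr_gt0.
set h := Num.min _ _ => ah bh eab.
have h1 : h <= 1 by rewrite ge_min lexx.
have h2 : h <= r * d / 2 by rewrite ge_min lexx orbT.
have h0 : 0 < h by rewrite lt_min ltr01 divr_gt0// mulr_gt0.
have s0 : 0 < r + h by lra.
have sN (v : X) : `|(r + h)^-1 *: v| = `|v| / (r + h).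
  by rewrite normrZ gtr0_norm ?invr_gt0// mulrC.
have : (d%:E <= (1 - `|2^-1 *: ((r + h)^-1 *: a + (r + h)^-1 *: b)|)%:E)%E.
  apply: le_trans dP _; apply: ereal_inf_lbound.
  exists ((r + h)^-1 *: a), ((r + h)^-1 *: b); split=> //.
  - by rewrite sN ler_pdivrMr// mul1r.
  - by rewrite sN ler_pdivrMr// mul1r.
  - rewrite -scalerBr sN ler_pM// ?invr_ge0; try lra.
    by rewrite lef_pV2 ?posrE; lra.
rewrite lee_fin -scalerDr scalerA mulrC -scalerA sN lerBrDr -lerBrDl.
rewrite ler_pdivrMr// => /le_trans; apply; nra.
Qed.

(** Points of [D n] of almost minimal norm form a Cauchy sequence: two late ones far apart would
    have a midpoint in some [D N] with norm below what [D N] allows. *)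
Lemma nested_midpoint_convex (R : realType) (X : completeNormedModType R)
    (D : nat -> set X) (M : R) :
  uniformly_convex X ->
  (forall n, midpoint_convex (D n)) -> (forall n, closed (D n)) ->
  (forall n m, (n <= m)%N -> D m `<=` D n) ->
  (forall n, exists2 z, D n z & `|z| <= M) ->
  exists z, forall n, D n z.
Proof.
move=> uc Dconv Dcl Ddecr Dbnd.
(* inf S is the limit of the distances from 0 to the sets D n. *)
pose S := [set s : R | forall n, exists2 z, D n z & `|z| <= s].
have S0 : lbound S 0 by move=> s /(_ 0%N)[z _]; exact: le_trans.
have hS : has_inf S by split; [exists M | exists 0].
have r0 : 0 <= inf S by apply: lb_le_inf => //; exists M.
have /choice[z zP] (n : nat) : exists z, D n z /\ `|z| <= inf S + n.+1%:R^-1.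
  have n0 : 0 < n.+1%:R^-1 :> R by rewrite invr_gt0.
  have [s Ss sr] := inf_adherent n0 hS.
  have [y Dy ys] := Ss n; exists y; split=> //; exact: le_trans (ltW sr).
have zcauchy : cauchy (z @ \oo).
  apply: cauchy_exP => e e0.
  have [h h0 hP] := uniformly_convex_midpoint uc r0 e0.
  (* As [inf S - h] is not in [S], some [D N] misses the ball of that radius. *)
  have [N NP] : exists N, forall y, D N y -> inf S - h < `|y|.
    apply: contrapT => nN; have : S (inf S - h).
      move=> n; apply: contrapT => nz; apply: nN; exists n => y Dy.
      by rewrite ltNge; apply/negP => yh; apply: nz; exists y.
    move=> /(ge_inf hS.2); lra.
  have [K _ KP] : \forall n \near \oo, n.+1%:R^-1 < h :> R.
    exact: near_infty_natSinv_lt (PosNum h0).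
  have zb n : (K <= n)%N -> `|z n| <= inf S + h.
    by move=> /KP/ltW Kn; apply: le_trans (zP n).2 _; rewrite lerD2l.
  have zD n : (N <= n)%N -> D N (z n) by move=> /Ddecr; apply; exact: (zP n).1.
  exists (z (maxn N K)), (maxn N K) => // n /=; rewrite geq_max => /andP[Nn Kn].
  rewrite -ball_normE/=; apply: contrapT => /negP; rewrite -leNgt => ez.
  have := hP _ _ (zb _ (leq_maxr N K)) (zb _ Kn) ez.
  have := NP _ (Dconv N _ _ (zD _ (leq_maxl N K)) (zD _ Nn)); lra.
move/cauchy_cvgP : zcauchy => /cvg_ex[l zl].
exists l => n; apply: (closed_cvg (D n) (Dcl n) _ _ zl).
by exists n => // m /= nm; apply: Ddecr nm _ (zP m).1.
Qed.

(** * Least upper bounds and weak limits of monotone sequences *)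

Lemma monotone_increasing_le (X : Type) (le : rel X) (u : nat -> X) :
  wochoice.preorder le -> monotone_increasing le u ->
  forall n m, (n <= m)%N -> le (u n) (u m).
Proof.
move=> [le_refl le_trans] uinc n m /subnK <-.
by elim: (m - n)%N => [|k IHk]; [exact: le_refl | exact: le_trans (uinc _)].
Qed.

(* G serves to locate the least upper bound, which does not depend on G: it is
   the whole space, or a half-space visited infinitely often by u. *)
Lemma monotone_lub (R : realType) (X : completeNormedModType R) (le : rel X)
    (C G : set X) (u : nat -> X) :
  wochoice.preorder le -> convex_closed_intervals le -> uniformly_convex X ->
  convex_set C -> closed C -> bounded_set C ->
  midpoint_convex G -> closed G ->
  monotone_increasing le u -> (forall n, C (u n)) ->
  (forall n, exists2 m, (n <= m)%N & G (u m)) ->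
  exists x, [/\ C x, G x, forall n, le (u n) x &
    forall y, (forall n, le (u n) y) -> le x y].
Proof.
move=> le_pre [leU leL] uc Cconv Ccl Cbnd Gconv Gcl uinc uC uG.
have u_le := monotone_increasing_le le_pre uinc.
have C_proper := globally_properfilter (uC 0%N).
have /ex_bound[M CM] := Cbnd.
(* A point common to all [D n] bounds [u] from above, and membership in [L] makes it the least such
   bound. Each [D n] contains a late term of [u] lying in [G]. *)
pose L := \bigcap_(y in [set y | forall n, le (u n) y]) lower_interval le y.
pose D n := C `&` G `&` upper_interval le (u n) `&` L.
have [||||x xD] := @nested_midpoint_convex R X D M uc.
- move=> n x y [[[Cx Gx] nx] Lx] [[[Cy Gy] ny] Ly]; split; last first.
    move=> b /[dup] bub /Lx xb; apply: convex_set_midpoint (leL b).1 _ _ xb _.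
    exact: Ly.
  split; last exact: convex_set_midpoint (leU _).1 _ _ nx ny.
  by split; [exact: convex_set_midpoint Cconv _ _ Cx Cy | exact: Gconv].
- move=> n; apply: closedI; last by apply: closed_bigI => y _; exact: (leL y).2.
  by apply: closedI (leU _).2; exact: closedI.
- move=> n m nm z [[Cz mz] Lz]; split=> //; split=> //.
  exact: (le_pre.2 _ _ _ (u_le _ _ nm)).
- move=> n; have [m nm Gm] := uG n.
  exists (u m); last exact: CM.
  by split=> [|b bub]; [split=> //; exact: u_le | exact: bub].
exists x; split=> [||n|y yub]; first by case: (xD 0%N) => -[[]].
- by case: (xD 0%N) => -[[]].
- by case: (xD n) => -[[]].
- by case: (xD 0%N) => _; exact.
Qed.

(** A half-space visited infinitely often contains a least upper bound of [u], which is [x] by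
    antisymmetry; so [u] eventually leaves every closed half-space that misses [x]. *)
Lemma monotone_weak_cvg (R : realType) (X : completeNormedModType R)
    (le : rel X) (C : set X) (u : nat -> X) (x : X) :
  wochoice.partial_order le -> convex_closed_intervals le ->
  uniformly_convex X -> convex_set C -> closed C -> bounded_set C ->
  monotone_increasing le u -> (forall n, C (u n)) ->
  (forall n, le (u n) x) -> (forall y, (forall n, le (u n) y) -> le x y) ->
  weakly_converges u x.
Proof.
move=> [le_pre le_anti] le_itv uc Cconv Ccl Cbnd uinc uC xub xlub f fcont.
(* The signs [s = 1] and [s = -1] give the two one-sided bounds. *)
have upper (s c : R) : s * f x < c -> \forall n \near \oo, s * f (u n) < c.
  move=> sfx; apply: contrapT => nlt.
  pose G := [set z | c <= s * f z].
  have [||n|y [_ Gy yub ylub]] :=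
    @monotone_lub R X le C G u le_pre le_itv uc Cconv Ccl Cbnd _ _ uinc uC.
  - move=> a b; rewrite /G/= linearZ linearD /= /(_ *: _) /=; nra.
  - apply: (@preimage_closed _ _ (fun z => s * f z) [set t | c <= t]).
      by move=> z _; apply: continuousM; [exact: cst_continuous | exact: fcont].
    exact: closed_ge.
  - apply: contrapT => nG; apply: nlt; exists n => // m /= nm.
    by rewrite ltNge; apply/negP => cm; apply: nG; exists m.
  - have xy : x = y by apply: le_anti; rewrite xlub // ylub.
    by move: Gy; rewrite /G/= -xy leNgt sfx.
apply/cvgrPdist_lt => e e0.
have h1 : 1 * f x < f x + e by rewrite mul1r ltrDl.
have h2 : -1 * f x < - f x + e by rewrite mulN1r ltrDl.
near=> n; rewrite ltr_distl.
have : 1 * f (u n) < f x + e by near: n; exact: upper.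
have : -1 * f (u n) < - f x + e by near: n; exact: upper.
by rewrite mul1r mulN1r => ? ?; apply/andP; split; lra.
Unshelve. all: by end_near. Qed.

(** * Asymptotic distances and the fixed point *)

Lemma limsup_dist_lt_near (R : realType) (X : normedModType R) (u : nat -> X)
    (y : X) (s : R) :
  (limsup_dist u y < s%:E)%E -> \forall n \near \oo, `|u n - y| < s.
Proof.
move=> /ereal_inf_lt[_ [A nA <-]] sA; apply: filterS nA => n An.
rewrite -lte_fin; apply: le_lt_trans sA.
by apply: ereal_sup_ubound; exists n.
Qed.

Lemma limsup_dist_le (R : realType) (X : normedModType R) (u : nat -> X)
    (y : X) (s : R) :
  (\forall n \near \oo, `|u n - y| <= s) -> (limsup_dist u y <= s%:E)%E.
Proof.
move=> us; apply: le_trans (ereal_inf_lbound _) _.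
  by exists [set n | `|u n - y| <= s].
by apply: ge_ereal_sup => _ [n /= ns <-]; rewrite lee_fin.
Qed.

(** Only the increasing half of the Opial condition is assumed, so that the lemma also applies to
    the reversed order. *)
Lemma increasing_orbit_fixpoint (R : realType) (X : completeNormedModType R)
    (le : rel X) (C : set X) (T : X -> X) (x0 : X) :
  wochoice.partial_order le -> convex_closed_intervals le ->
  uniformly_convex X -> convex_set C -> closed C -> bounded_set C ->
  (forall (u : nat -> X) (x : X),
     monotone_increasing le u -> weakly_converges u x ->
     forall y, le x y -> (limsup_dist u x <= limsup_dist u y)%E) ->
  (forall x, C x -> C (T x)) -> monotone_asymptotic_nonexpansive le C T ->
  C x0 -> le x0 (T x0) -> exists x, C x /\ T x = x.
Proof.
move=> le_po le_itv uc Cconv Ccl Cbnd Opial TC [Tmono [k [k0 k1 kT]]] Cx0 x0T.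
have [[le_refl le_trs] le_anti] := le_po.
have iterC x n : C x -> C (iter n T x) by move=> Cx; elim: n => //= n /TC.
have iter_inc x :
    C x -> le x (T x) -> monotone_increasing le (fun n => iter n T x).
  move=> Cx xT; elim=> //= n IHn.
  by apply: Tmono IHn; [exact: iterC | exact: (iterC x n.+1)].
pose u n := iter n T x0.
have uinc : monotone_increasing le u := iter_inc _ Cx0 x0T.
have uC n : C (u n) := iterC x0 n Cx0.
have [||n|x [Cx _ xub xlub]] :=
  @monotone_lub R X le C setT u le_po.1 le_itv uc Cconv Ccl Cbnd _ _ uinc uC.
- by [].
- exact: closedT.
- by exists n.
have u_x : weakly_converges u x by exact: monotone_weak_cvg uinc uC xub xlub.
have T_ub y : C y -> (forall n, le (u n) y) -> forall n, le (u n) (T y).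
  by move=> Cy yub n; apply: le_trs (uinc n) _; exact: Tmono (yub n).
pose v m := iter m T x.
have vC m : C (v m) := iterC x m Cx.
have v_ub m n : le (u n) (v m) by elim: m n => [|m IHm] //=; exact: T_ub.
have xT : le x (T x) by exact: xlub (v_ub 1%N).
have vinc : monotone_increasing le v := iter_inc _ Cx xT.
have [r r0 rE] : exists2 r : R, 0 <= r & limsup_dist u x = r%:E.
  have C_proper := globally_properfilter Cx.
  have /ex_bound[M CM] := Cbnd.
  have : (limsup_dist u x <= (M + M)%:E)%E.
    apply: limsup_dist_le; apply: nearW => n.
    by apply: le_trans (ler_normB _ _) _; apply: lerD; exact: CM.
  have : (0 <= limsup_dist u x)%E by apply: limf_esup_ge0 => // -[N _ /(_ N)]; exact.
  by case: limsup_dist => // r; exists r.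
have v_x : v m @[m --> \oo] --> x.
  apply/cvgrPdist_lt => e e0.
  have [h h0 hP] := uniformly_convex_midpoint uc r0 e0.
  have rh : 0 < r + h / 2 by lra.
  have ux : \forall n \near \oo, `|u n - x| < r + h / 2.
    by apply: limsup_dist_lt_near; rewrite rE lte_fin; lra.
  (* This threshold exceeds 1 and turns the bound [r + h / 2] into [r + h] after multiplication by
     [k m]. *)
  have : \forall m \near \oo, k m < (r + h) / (r + h / 2).
    by apply: (cvgr_lt _ k1); rewrite ltr_pdivlMr//; lra.
  apply: filterS => m; rewrite ltr_pdivlMr// => km.
  rewrite ltNge; apply/negP => em.
  have uv : \forall n \near \oo, `|u n - v m| <= r + h.
    (* The shift by [m] allows writing [u n] as the [m]-th iterate of [u (n - m)] with [n - m] still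
       at least [N]. *)
    case: ux => N _ uN; exists (N + m)%N => //= n Nmn.
    have mn : (m <= n)%N by exact: leq_trans (leq_addl N m) Nmn.
    have := kT m _ _ (uC (n - m)%N) Cx (or_introl (xub _)).
    rewrite /u -iterD subnKC// => /le_trans; apply; apply: le_trans (ltW km).
    apply: ler_wpM2l; first exact: ltW.
    by apply/ltW/uN; rewrite /= leq_subRL// addnC.
  have : (limsup_dist u (2^-1 *: (x + v m)) <= (r - h)%:E)%E.
    apply: limsup_dist_le; near=> n.
    have -> : u n - 2^-1 *: (x + v m) = 2^-1 *: ((u n - x) + (u n - v m)).
      rewrite addrACA -opprD scalerBr; congr (_ - _).
      by rewrite -mulr2n -[u n *+ 2]scaler_nat scalerA mulVf ?scale1r// pnatr_eq0.
    apply: hP.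
    - have : `|u n - x| < r + h / 2 by near: n.
      by lra.
    - by near: n.
    - by rewrite opprB addrC subrKA distrC.
  (* Convexity of [[x, ->)] makes the midpoint a legitimate competitor in the Opial condition, which
     its limsup [r - h] then violates. *)
  have x_mid : le x (2^-1 *: (x + v m)).
    apply: (convex_set_midpoint (le_itv.1 x).1); first exact: le_refl.
    exact: xlub (v_ub m).
  move/(le_trans (Opial _ _ uinc u_x _ x_mid)); rewrite rE lee_fin; lra.
exists x; split=> //; apply: le_anti; rewrite xT andbT.
(* The interval [[T x, ->)] is closed and contains [v m] from [m = 1] on, so it contains the limit
   [x]. *)
apply: (closed_cvg _ (le_itv.1 (T x)).2 _ _ v_x).
exists 1%N => // m /= m1.
exact: (monotone_increasing_le le_po.1 vinc m1).
Unshelve. all: by end_near. Qed.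

Theorem theorem3p6 (R : realType) (X : completeNormedModType R) (le : rel X)
    (le_order : wochoice.partial_order le)
    (le_intervals : convex_closed_intervals le)
    (X_uc : uniformly_convex X)
    (C : set X)
    (C_neq0 : C !=set0) (C_convex : convex_set C) (C_closed : closed C)
    (C_bounded : bounded_set C) (C_not_singleton : forall a : X, C <> [set a])
    (X_Opial : monotone_weak_Opial le)
    (T : {fun C >-> C})
    (T_man : monotone_asymptotic_nonexpansive le C T) :
  (exists x, C x /\ T x = x) <->
  (exists x0, C x0 /\ comparable_for le x0 (T x0)).
Proof.
have [[le_refl le_trs] le_anti] := le_order.
have TC x : C x -> C (T x) by exact: funS.
split=> [[x [Cx Tx]]|[x [Cx [xT|Tx]]]].
- by exists x; split=> //; left; rewrite Tx; exact: le_refl.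
- exact: increasing_orbit_fixpoint X_Opial.1 TC T_man Cx xT.
(* Reversing the order swaps the two kinds of intervals and the two halves of the Opial condition,
   and makes the orbit increasing. *)
pose ge : rel X := fun a b => le b a.
have ge_order : wochoice.partial_order ge.
  split; last by move=> a b; rewrite andbC; exact: le_anti.
  by split=> // b a c ba cb; exact: le_trs cb ba.
have ge_intervals : convex_closed_intervals ge.
  by split; [exact: le_intervals.2 | exact: le_intervals.1].
have T_ge : monotone_asymptotic_nonexpansive ge C T.
  case: T_man => Tmono [k [k0 k1 kT]]; split.
    by move=> a b Ca Cb; exact: Tmono.
  by exists k; split=> // n a b Ca Cb /or_comm; exact: kT.
exact: (increasing_orbit_fixpoint ge_order ge_intervals X_uc C_convex C_closed
  C_bounded X_Opial.2 TC T_ge Cx).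
Qed.
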